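(* Any irreducible Hilbert space representation of the $C^*$-algebra $A_s(4)=C(\mathcal{Q}_4)$ is finite dimensional, and has dimension $1$, $2$ or $4$.
   Context: $A_s(4)=C(\mathcal{Q}_4)$ is the universal unital $C^*$-algebra generated by $(u_{ij})_{1\le i,j\le4}$ with the relations making $u=(u_{ij})$ a magic unitary: every $u_{ij}$ is a projection, distinct entries on the same row or same column are orthogonal, and the sum of the entries of each row and of each column equals $1$. Representations are $*$-representations. *)

(* Defs.v *)
From HB Require Import structures.
From mathcomp Require Import all_boot all_order all_algebra.
From mathcomp Require Import complex.
From mathcomp Require Import all_classical all_reals all_analysis.

Set Implicit Arguments.
Unset Strict Implicit.
Unset Printing Implicit Defensive.

Import Order.TTheory GRing.Theory Num.Theory.
Import numFieldNormedType.Exports.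

Local Open Scope classical_set_scope.
Local Open Scope ring_scope.
Local Open Scope complex_scope.

(* Complex scalars are [R[i]] for [R : realType]. The norm of a
   [normedModType R[i]] takes its values in [R[i]], where [0 <= z] means that
   [z] is real and nonnegative. [dot] is linear in its first argument and
   conjugate-linear in the second one. *)
HB.mixin Record hasInnerProduct (R : realType) H
    of CompleteNormedModule R[i] H := {
  dot : {dot H for @Num.conj R[i]} ;
  sqr_norm_dot : forall x : H, `|x| ^+ 2 = dot x x }.

#[short(type="hilbertType")]
HB.structure Definition Hilbert (R : realType) :=
  {H of CompleteNormedModule R[i] H & hasInnerProduct R H}.

(* Unital C*-algebras. The norm is a separate field [cstar_norm], with values
   in [R], because MathComp has no structure below [numDomainType] joining
   rings and normed modules. [algType] includes [1 != 0], so the zero algebra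
   is excluded. *)
HB.mixin Record isCStarAlgebra (R : realType) A of GRing.Algebra R[i] A := {
  star : A -> A ;
  starD : forall a b : A, star (a + b) = star a + star b ;
  starZ : forall (z : R[i]) (a : A), star (z *: a) = Num.conj z *: star a ;
  starM : forall a b : A, star (a * b) = star b * star a ;
  starK : forall a : A, star (star a) = a ;
  cstar_norm : A -> R ;
  cstar_norm_eq0 : forall a : A, cstar_norm a = 0 -> a = 0 ;
  cstar_normD : forall a b : A,
    cstar_norm (a + b) <= cstar_norm a + cstar_norm b ;
  cstar_normZ : forall (z : R[i]) (a : A),
    (cstar_norm (z *: a))%:C = `|z| * (cstar_norm a)%:C ;
  cstar_normM : forall a b : A,
    cstar_norm (a * b) <= cstar_norm a * cstar_norm b ;
  cstar_identity : forall a : A, cstar_norm (star a * a) = cstar_norm a ^+ 2 ;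
  cstar_complete : forall s : nat -> A,
    (forall e : R, 0 < e -> exists N : nat, forall m n : nat,
       (N <= m)%N -> (N <= n)%N -> cstar_norm (s m - s n) < e) ->
    exists a : A, forall e : R, 0 < e -> exists N : nat, forall n : nat,
       (N <= n)%N -> cstar_norm (s n - a) < e }.

#[short(type="cstarAlgType")]
HB.structure Definition CStarAlgebra (R : realType) :=
  {A of GRing.Algebra R[i] A & isCStarAlgebra R A}.

Section MagicUnitary.
Variables (R : realType) (n : nat).

Definition is_projection (A : cstarAlgType R) (p : A) : Prop :=
  star p = p /\ p * p = p.

Record magic_unitary (A : cstarAlgType R) (u : 'M[A]_n) : Prop := {
  magic_projection : forall i j, is_projection (u i j) ;
  magic_row_ortho : forall i j k, j != k -> u i j * u i k = 0 ;
  magic_col_ortho : forall i j k, i != j -> u i k * u j k = 0 ;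
  magic_row_sum : forall i, \sum_j u i j = 1 ;
  magic_col_sum : forall j, \sum_i u i j = 1 }.

Record star_subalgebra (A : cstarAlgType R) (S : set A) : Prop := {
  star_sub1 : S 1 ;
  star_sub_lin : forall (z : R[i]) a b, S a -> S b -> S (z *: a + b) ;
  star_subM : forall a b, S a -> S b -> S (a * b) ;
  star_sub_star : forall a, S a -> S (star a) }.

(* The *-subalgebra generated by the entries of [u] is norm-dense in [A]. *)
Definition generates (A : cstarAlgType R) (u : 'M[A]_n) : Prop :=
  forall S : set A, star_subalgebra S -> (forall i j, S (u i j)) ->
  forall (a : A) (e : R), 0 < e -> exists2 b, S b & cstar_norm (a - b) < e.

Definition star_preserving (A B : cstarAlgType R) (f : A -> B) : Prop :=
  forall a, f (star a) = star (f a).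

(* [A], with the matrix [u], is the universal unital C*-algebra A_s(n)
   generated by the entries of an n x n magic unitary; this determines the
   pair [(A, u)] up to a unique isomorphism. The elements of
   [{lrmorphism A -> B}] are unital; no continuity is required of them because
   *-homomorphisms between C*-algebras are contractive. *)
Record is_As (A : cstarAlgType R) (u : 'M[A]_n) : Prop := {
  As_magic : magic_unitary u ;
  As_generated : generates u ;
  As_universal : forall (B : cstarAlgType R) (v : 'M[B]_n), magic_unitary v ->
    exists f : {lrmorphism A -> B},
      [/\ star_preserving f,
          forall i j, f (u i j) = v i j &
          forall g : {lrmorphism A -> B}, star_preserving g ->
            (forall i j, g (u i j) = v i j) -> g =1 f] }.

End MagicUnitary.

Section Representations.
Variables (R : realType) (A : cstarAlgType R) (H : hilbertType R).

(* A *-homomorphism from [A] to the bounded operators on [H]: a linear operator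
   is continuous if and only if it is bounded, and [rep_star] says that the
   adjoint of [rho a] is [rho (star a)]. The condition [rho 1 = 1] is not
   imposed. *)
Record star_representation (rho : A -> {linear H -> H}) : Prop := {
  rep_bounded : forall a, continuous (rho a) ;
  rep_lin : forall (z : R[i]) a b x,
    rho (z *: a + b) x = z *: rho a x + rho b x ;
  repM : forall a b x, rho (a * b) x = rho a (rho b x) ;
  rep_star : forall a x y, dot (rho a x) y = dot x (rho (star a) y) }.

Record closed_subspace (K : set H) : Prop := {
  csub_closed : closed K ;
  csub0 : K 0 ;
  csub_lin : forall (z : R[i]) x y, K x -> K y -> K (z *: x + y) }.

Definition irreducible_rep (rho : A -> {linear H -> H}) : Prop :=
  (exists x : H, x != 0) /\
  forall K : set H, closed_subspace K -> (forall a x, K x -> K (rho a x)) ->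
    K = [set 0] \/ K = setT.

End Representations.

(* [H] is finite dimensional, of dimension [d]: it is linearly isomorphic to
   ['rV[R[i]]_d]. *)
Definition has_dim (R : realType) (H : hilbertType R) (d : nat) : Prop :=
  inhabited (Vector.axiom d H).

(* Main.v *)
(* The Fourier transform over the Klein group Z/2 x Z/2, applied to rows and
   columns of the magic unitary u, gives self-adjoint elements a_ij
   (i, j in Z/2 x Z/2) that commute or anticommute exactly as the tensors
   sigma_i (x) sigma_j of Pauli matrices do (A_s(4) is the algebra of SO_{-1}(3)).
   Hence the squares a_ij^2 are central, so they are scalars in an irreducible
   representation, and the nonzero a_ij can be normalised to self-adjoint
   unitaries. Monomials in them are indexed, up to radical monomials, which are
   again scalar, by a subspace of the symplectic space F_2^4; such a subspace
   contains r <= 2 hyperbolic pairs, and a joint eigenvector of one half of the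
   pairs, moved around by the other half, is an orthogonal basis of 2^r vectors.
   Schur's lemma for bounded operators and the contractivity of
   *-representations (needed to pass from the *-algebra generated by the u_ij to
   its closure) both come from one elementary construction of square roots. *)
Require Import Defs.
From mathcomp Require Import all_boot all_order all_algebra.
From mathcomp Require Import complex.
From mathcomp Require Import all_classical all_reals all_analysis.
From mathcomp Require Import ring lra.
Import Order.TTheory GRing.Theory Num.Theory.
Import numFieldNormedType.Exports.
Set Implicit Arguments.
Unset Strict Implicit.
Unset Printing Implicit Defensive.
Local Open Scope ring_scope.
Local Open Scope complex_scope.

(** * The real-valued norm of a Hilbert space *)

Section RealNorm.
Variables (R : realType) (H : hilbertType R).
Implicit Types x y : H.

(** Taking values in [R] gives Hilbert spaces the same interface as [cstar_norm], so both can be fed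
    to [contraction_sqrt]. *)
Definition rnorm x : R := complex.Re `|x|.

Lemma norm_rnorm x : `|x| = (rnorm x)%:C.
Proof. by rewrite /rnorm RRe_real // ger0_real. Qed.

Lemma rnorm_ge0 x : 0 <= rnorm x.
Proof. by rewrite -ler0c -norm_rnorm. Qed.

Lemma rnorm0_eq0 x : rnorm x = 0 -> x = 0.
Proof. by move=> x0; apply/eqP; rewrite -normr_eq0 norm_rnorm x0. Qed.

Lemma rnorm0 : rnorm 0 = 0.
Proof. by rewrite /rnorm normr0. Qed.

Lemma rnormD x y : rnorm (x + y) <= rnorm x + rnorm y.
Proof. by have := ler_normD x y; rewrite !norm_rnorm -rmorphD lecR. Qed.

Lemma rnormZ z x : (rnorm (z *: x))%:C = `|z| * (rnorm x)%:C.
Proof. by rewrite -!norm_rnorm normrZ. Qed.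

Lemma rnormB x y : rnorm (x - y) = rnorm (y - x).
Proof. by rewrite /rnorm distrC. Qed.

Lemma sqr_rnorm x : ((rnorm x) ^+ 2)%:C = dot x x.
Proof. by rewrite -sqr_norm_dot norm_rnorm rmorphXn. Qed.

Lemma closed_rnormP (K : set H) :
  closed K <-> forall x, (forall e : R, 0 < e ->
    exists2 y, K y & rnorm (x - y) < e) -> K x.
Proof.
split=> [clK x Kx|Kx].
  apply: clK => B /nbhs_ballP[e /= e0 eB].
  have [e' e'0 ee'] : exists2 e' : R, 0 < e' & e = e'%:C.
    exists (complex.Re e); last by rewrite RRe_real // gtr0_real.
    by rewrite -ltcR RRe_real // gtr0_real.
  have [y Ky xy] := Kx _ e'0; exists y; split => //; apply: eB.
  by rewrite -ball_normE /= norm_rnorm ee' ltcR.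
move=> x clx; apply: Kx => e e0.
have /clx[y [Ky]] : nbhs x (ball x (e%:C)) by apply: nbhsx_ballx; rewrite ltcR.
by rewrite -ball_normE /= norm_rnorm ltcR => xy; exists y.
Qed.

Lemma rnorm_complete (s : nat -> H) :
  (forall e : R, 0 < e -> exists N : nat, forall m n : nat,
     (N <= m)%N -> (N <= n)%N -> rnorm (s m - s n) < e) ->
  exists a : H, forall e : R, 0 < e -> exists N : nat, forall n : nat,
     (N <= n)%N -> rnorm (s n - a) < e.
Proof.
move=> cs.
have /cauchy_cvgP/cvg_ex[l sl] : cauchy (s @ \oo)%classic.
  apply/cauchy_exP => e e0.
  have e'0 : 0 < complex.Re e by rewrite -ltcR RRe_real // gtr0_real.
  have [N sN] := cs _ e'0; exists (s N); exists N => // n /= Nn.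
  by rewrite -ball_normE /= norm_rnorm -[ltRHS]RRe_real ?gtr0_real // ltcR sN.
exists l => e e0.
have e'0 : 0 < e%:C by rewrite ltcR.
have [N _ sN] := (cvgrPdist_lt _ _).1 sl _ e'0.
by exists N => n Nn; rewrite rnormB -ltcR -norm_rnorm; apply: sN.
Qed.

Lemma continuous_rnorm_bounded (f : {linear H -> H}) : continuous f ->
  exists C : R, forall x, rnorm (f x) <= C * rnorm x.
Proof.
move=> /linear_bounded_continuous/linear_boundedP/pinfty_ex_gt0[C C0 fC].
exists (complex.Re C) => x.
by rewrite -lecR rmorphM /= -!norm_rnorm RRe_real ?gtr0_real.
Qed.
End RealNorm.

(** * Square roots *)

Section LinearFunctions.
Variables (C : nzRingType) (V : lmodType C) (F : V -> V).
Hypothesis F_lin : linear F.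

Lemma linear_funD x y : F (x + y) = F x + F y.
Proof. by have := F_lin 1 x y; rewrite !scale1r. Qed.

Lemma linear_fun0 : F 0 = 0.
Proof. by apply: (addrI (F 0)); rewrite -linear_funD !addr0. Qed.

Lemma linear_funZ c x : F (c *: x) = c *: F x.
Proof. by have := F_lin c x 0; rewrite linear_fun0 !addr0. Qed.

Lemma linear_funB x y : F (x - y) = F x - F y.
Proof. by rewrite -scaleN1r addrC F_lin scaleN1r addrC. Qed.
End LinearFunctions.

Section LinearFunctionOperations.
Variables (C : comNzRingType) (V : lmodType C).
Implicit Types F G : V -> V.

Lemma linear_fun_id : linear (@id V).
Proof. by []. Qed.

Lemma linear_fun_comp F G : linear F -> linear G -> linear (fun x => F (G x)).
Proof. by move=> Fl Gl c x y; rewrite Gl Fl. Qed.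

Lemma linear_fun_add F G : linear F -> linear G -> linear (fun x => F x + G x).
Proof. by move=> Fl Gl c x y; rewrite Fl Gl scalerDr addrACA. Qed.

Lemma linear_funZr d F : linear F -> linear (fun x => d *: F x).
Proof. by move=> Fl c x y; rewrite Fl scalerDr !scalerA mulrC. Qed.

Lemma linear_fun_sub F G : linear F -> linear G -> linear (fun x => F x - G x).
Proof. by move=> Fl Gl c x y; rewrite Fl Gl scalerBr opprD addrACA. Qed.
End LinearFunctionOperations.

(** * Real-valued seminorms on complex vector spaces *)

Section ComplexSeminorm.
Variables (R : realType) (V : lmodType R[i]) (N : V -> R).
Hypothesis ND : forall x y, N (x + y) <= N x + N y.
Hypothesis NZ : forall c x, (N (c *: x))%:C = `|c| * (N x)%:C.

Lemma seminormZ c x : N (c *: x) = complex.Re `|c| * N x.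
Proof. by apply: complexI; rewrite NZ [RHS]rmorphM; congr (_ * _). Qed.

Lemma seminorm_half x : N (2^-1 *: x) = 2^-1 * N x.
Proof.
rewrite seminormZ ger0_norm ?invr_ge0 ?ler0n //; congr (_ * _).
by rewrite -(rmorph_nat (real_complex R)) -fmorphV.
Qed.

Lemma seminormN x : N (- x) = N x.
Proof. by rewrite -scaleN1r seminormZ normrN1 mul1r. Qed.

Lemma seminorm0 : N 0 = 0.
Proof. by have := seminorm_half 0; rewrite scaler0; lra. Qed.

Lemma seminorm_ge0 x : 0 <= N x.
Proof. by have := ND x (- x); rewrite subrr seminorm0 seminormN; lra. Qed.
End ComplexSeminorm.

Section ContractionSqrt.
Variables (R : realType) (V : lmodType R[i]) (N : V -> R).
Hypothesis N_eq0 : forall x, N x = 0 -> x = 0.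
Hypothesis ND : forall x y, N (x + y) <= N x + N y.
Hypothesis NZ : forall c x, (N (c *: x))%:C = `|c| * (N x)%:C.
Hypothesis N_complete : forall s : nat -> V,
  (forall e : R, 0 < e -> exists M : nat, forall m n : nat,
     (M <= m)%N -> (M <= n)%N -> N (s m - s n) < e) ->
  exists a : V, forall e : R, 0 < e -> exists M : nat, forall n : nat,
     (M <= n)%N -> N (s n - a) < e.
Variable X : V -> V.
Hypothesis X_lin : linear X.
Hypothesis X_le : forall x, N (X x) <= N x.

(* The fixed point L = (X + L^2) / 2 of this iteration satisfies
   (1 - L)^2 = 1 - X. Every iterate is a polynomial in X with nonnegative
   coefficients, so errors are dominated by those of the scalar iteration at
   X = 1, which is [sqrt_rate]; no positivity of X is needed. *)
Fixpoint sqrt_iter n (x : V) : V :=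
  if n is n.+1 then 2^-1 *: (X x + sqrt_iter n (sqrt_iter n x)) else 0.

Fixpoint sqrt_rate n : R :=
  if n is n.+1 then 2^-1 * (1 + sqrt_rate n ^+ 2) else 0.

Let N_scale := seminormZ NZ.
Let N_half := seminorm_half NZ.
Let N_opp := seminormN NZ.
Let N0 := seminorm0 NZ.
Let N_ge0 := seminorm_ge0 ND NZ.

Let Z := sqrt_iter.
Let z := sqrt_rate.

(** The fixed point 1 of [t -> (1 + t^2) / 2] has derivative 1, so convergence is not geometric: the
    error [d] becomes [d - d^2 / 2], which decays like [2 / n]. *)
Let sqrt_rate_bound n : [/\ 0 <= z n, z n <= 1 & (1 - z n) * n.+2%:R <= 2].
Proof.
elim: n => [|n [z0 z1 zn]] /=; first by split; lra.
split; [nra | nra | ].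
have n0 : 0 <= n%:R :> R by [].
move: zn z0 z1; rewrite -/z -[n.+3%:R]natr1; move: (z n) => t.
have : 2 <= n.+2%:R :> R by rewrite ler_nat.
move: n.+2%:R => k k2 tk t0 t1.
have k0 : 0 < k * k by nra.
(* With [s = (1 - t) k] the left side is [s (2k - s)], increasing for [s <= k], and
   [s <= 2 <= k]. *)
have h : (1 - t) * (1 + t) * (k * k) <= 4 * (k - 1).
  have : 0 <= (2 - (1 - t) * k) * (2 * k - 2 - (1 - t) * k).
    by apply: mulr_ge0; nra.
  nra.
rewrite -(ler_pM2r k0); nra.
Qed.

Let sqrt_rate_le1 n : z n <= 1. Proof. by have [] := sqrt_rate_bound n. Qed.
Let sqrt_rate_ge0 n : 0 <= z n. Proof. by have [] := sqrt_rate_bound n. Qed.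

Let sqrt_rate_cvg (e : R) : 0 < e -> exists n, 1 - z n < e.
Proof.
move=> e0; have := archi_boundP (ltW (divr_gt0 (ltr0Sn R 1) e0)).
move: (Num.bound _) => n; rewrite ltr_pdivrMr // => en; exists n.
have [z0 z1 zn] := sqrt_rate_bound n.
have n0 : 0 <= n%:R :> R by [].
by move: zn; rewrite -!natr1 ltNge => zn; apply/negP => ez; nra.
Qed.

Let sqrt_rate_mono m n : (m <= n)%N -> z m <= z n.
Proof.
move=> /subnK <-; elim: (n - m)%N => // k IH; apply: (le_trans IH).
rewrite addSn /=; have := sqrt_rate_le1 (k + m); rewrite -/z; nra.
Qed.

Let sqrt_iter_linear n : linear (Z n).
Proof.
elim: n => [|n IH] c x y /=; first by rewrite scaler0 addr0.
rewrite X_lin !IH -!/(Z _) scalerA mulrC -scalerA -scalerDr.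
congr (_ *: _); rewrite scalerDr !addrA; congr (_ + _).
by rewrite -!addrA; congr (_ + _); rewrite addrC.
Qed.

Let sqrt_iter_comm n (F : V -> V) : linear F ->
  (forall x, F (X x) = X (F x)) -> forall x, F (Z n x) = Z n (F x).
Proof.
move=> Fl FX; elim: n => [|n IH] x /=; first exact: linear_fun0.
by rewrite (linear_funZ Fl) (linear_funD Fl) FX !IH.
Qed.

Let sqrt_iterC m n x : Z m (Z n x) = Z n (Z m x).
Proof.
apply: (sqrt_iter_comm n (sqrt_iter_linear m)) => {}x.
by rewrite (sqrt_iter_comm m X_lin).
Qed.

Let NBC x y : N (x - y) = N (y - x).
Proof. by rewrite -N_opp opprB. Qed.

Let NBD y x w : N (x - w) <= N (x - y) + N (y - w).
Proof. by rewrite (le_trans _ (ND _ _)) // addrA subrK. Qed.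

Let sqrt_iter_le n x : N (Z n x) <= z n * N x.
Proof.
elim: n x => [|n IH] x /=; first by rewrite mul0r N0.
have h := le_trans (IH _) (ler_wpM2l (sqrt_rate_ge0 n) (IH x)).
rewrite N_half; have := ND (X x) (Z n (Z n x)); have := X_le x.
rewrite -/Z -/z; move: h; rewrite mulrA -expr2; nra.
Qed.

(** The iterates commute, so a difference of squares factors as [(Z n.+1 + Z n) (Z n.+1 - Z n)]; the
    scalar iteration factors in the same way and dominates term by term. *)
Let sqrt_iterS n x : N (Z n.+1 x - Z n x) <= (z n.+1 - z n) * N x.
Proof.
elim: n x => [|n IH] x.
  have := sqrt_iter_le 1 x; rewrite /= !subr0; lra.
set y := Z n.+1 x - Z n x.
have -> : Z n.+2 x - Z n.+1 x = 2^-1 *: (Z n.+1 y + Z n y).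
  rewrite /y !(linear_funB (sqrt_iter_linear _)) (sqrt_iterC n n.+1) /Z.
  rewrite addrA subrK -scalerBr; congr (_ *: _).
  by rewrite opprD addrACA subrr add0r.
rewrite N_half; have := ND (Z n.+1 y) (Z n y).
have := le_trans (sqrt_iter_le n.+1 y) (ler_wpM2l (sqrt_rate_ge0 n.+1) (IH x)).
have := le_trans (sqrt_iter_le n y) (ler_wpM2l (sqrt_rate_ge0 n) (IH x)).
have -> : z n.+2 = 2^-1 * (1 + z n.+1 ^+ 2) by [].
have : z n.+1 = 2^-1 * (1 + z n ^+ 2) by [].
move: (z n.+1) (z n) => a b ->; lra.
Qed.

Let sqrt_iter_cauchy m n x : (m <= n)%N ->
  N (Z n x - Z m x) <= (z n - z m) * N x.
Proof.
move=> /subnK <-; elim: (n - m)%N => [|k IH]; first by rewrite !subrr mul0r N0.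
rewrite addSn; have := sqrt_iterS (k + m) x.
have := NBD (Z (k + m) x) (Z (k + m).+1 x) (Z m x); lra.
Qed.

Let le_sqrt_rate (a C : R) : (forall n, a <= C * (1 - z n)) -> a <= 0.
Proof.
move=> aC; rewrite leNgt; apply/negP => a0.
have C0 : 0 < C by have := aC 0; have := sqrt_rate_ge0 0; rewrite /=; lra.
have [n] := sqrt_rate_cvg (divr_gt0 a0 C0).
by rewrite ltr_pdivlMr // mulrC ltNge aC.
Qed.

Let eq_sqrt_rate x y C : (forall n, N (x - y) <= C * (1 - z n)) -> x = y.
Proof.
move=> h; apply/eqP; rewrite -subr_eq0; apply/eqP/N_eq0/le_anti.
by rewrite N_ge0 andbT (le_sqrt_rate h).
Qed.

(** [L] is the pointwise limit of the iterates. The fourth clause carries a relation between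
    iterates over to the limit; it asks only additivity of [F], so that it covers the
    conjugate-linear [star]. The fifth says that [L] commutes with all bounded linear maps that
    commute with [X]. *)
Lemma contraction_sqrt : exists L : V -> V,
  [/\ linear L, forall x, N (L x) <= N x,
      forall x, 2 *: L x = X x + L (L x),
      forall (F : V -> V) (C : R), (forall x y, F (x - y) = F x - F y) ->
        (forall x, N (F x) <= C * N x) ->
        forall x y, (forall n, F (sqrt_iter n x) = sqrt_iter n y) ->
        F (L x) = L y &
      forall F : V -> V, linear F -> (exists C, forall x, N (F x) <= C * N x) ->
        (forall x, F (X x) = X (F x)) -> forall x, F (L x) = L (F x) ].
Proof.
have lim x : exists l, forall n, N (Z n x - l) <= (1 - z n) * N x.
  have [|l lP] := N_complete (s := fun n => Z n x).
    move=> e e0.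
    have x0 : 0 < N x + 1 by have := N_ge0 x; lra.
    have [M Me] := sqrt_rate_cvg (divr_gt0 e0 x0); exists M => m n Mm Mn.
    wlog mn : m n Mm Mn / (m <= n)%N => [h|].
      by have [/h|/ltnW/h] := leqP m n; [apply | rewrite NBC; apply].
    rewrite NBC (le_lt_trans (sqrt_iter_cauchy x mn)) //.
    move: Me; rewrite ltr_pdivlMr //; have := sqrt_rate_mono Mm.
    have := sqrt_rate_le1 n; have := sqrt_rate_le1 M; have := N_ge0 x; nra.
  exists l => n; apply/ler_addgt0Pr => e /lP[M /(_ (maxn M n))].
  rewrite leq_maxl => /(_ isT); have := sqrt_iter_cauchy x (leq_maxr M n).
  rewrite (NBC _ (Z n x)) => h1 h2.
  have := sqrt_rate_le1 (maxn M n); have := NBD (Z (maxn M n) x) (Z n x) l.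
  have := N_ge0 x; nra.
have [L LP] := choice lim; exists L.
have NL x : N (L x) <= N x.
  by have := LP x 0; rewrite /= sub0r N_opp subr0 mul1r.
have Lext (F : V -> V) C : (forall x y, F (x - y) = F x - F y) ->
    (forall x, N (F x) <= C * N x) ->
    forall x y, (forall n, F (Z n x) = Z n y) -> F (L x) = L y.
  move=> FB FC x y Fxy; apply: (@eq_sqrt_rate _ _ (`|C| * N x + N y)) => n.
  have := NBD (F (Z n x)) (F (L x)) (L y).
  rewrite {2}Fxy -FB; have := FC (L x - Z n x); rewrite (NBC (L x)).
  have := LP y n; have := ler_wpM2l (normr_ge0 C) (LP x n).
  have := ler_wpM2r (N_ge0 (Z n x - L x)) (ler_norm C); lra.
have Llin : linear L.
  move=> c x y; apply: (@eq_sqrt_rate _ _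
    (N (c *: x + y) + complex.Re `|c| * N x + N y)) => n.
  have := LP (c *: x + y) n.
  have := NBD (Z n (c *: x + y)) (L (c *: x + y)) (c *: L x + L y).
  have := ND (c *: (Z n x - L x)) (Z n y - L y).
  rewrite N_scale sqrt_iter_linear scalerBr addrACA -opprD.
  rewrite (NBC (L (c *: x + y)) (_ + Z n y)).
  have c0 : 0 <= complex.Re `|c| by rewrite -ler0c RRe_real // ger0_real.
  have := ler_wpM2l c0 (LP x n); have := LP y n.
  lra.
split => //.
(* The defect of the fixed point equation is a sum of three terms, bounded by 2, 1 and 1 times
   [(1 - z n) N x]. *)
- move=> x; apply: (@eq_sqrt_rate _ _ (4 * N x)) => n.
  have e : 2 *: L x - (X x + L (L x)) =
      2 *: (L x - Z n.+1 x) + (Z n (Z n x - L x) + (Z n (L x) - L (L x))).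
    rewrite (linear_funB (sqrt_iter_linear n)) subrKA scalerBr.
    rewrite [Z n.+1 x]/= scalerA divff ?pnatr_eq0 // scale1r !opprD !addrA.
    by rewrite subrK.
  rewrite {}e; set a := L x - _; set b := Z n _; set d := Z n _ - _.
  have := ND (2 *: a) (b + d); have := ND b d.
  have : N (2 *: a) <= 2 * N a.
    by rewrite scaler_nat mulr2n mulrDl mul1r ND.
  have := LP x n.+1; rewrite NBC -/a; have := LP (L x) n; rewrite -/d.
  have := sqrt_iter_le n (Z n x - L x); rewrite -/b.
  have := LP x n; have := ler_wpM2r (N_ge0 x) (sqrt_rate_mono (leqnSn n)).
  have := ler_wpM2r (N_ge0 (Z n x - L x)) (sqrt_rate_le1 n).
  have z1 : 0 <= 1 - z n by rewrite subr_ge0.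
  have := ler_wpM2l z1 (NL x).
  lra.
- move=> F Fl [C FC] FX x; apply: (Lext F C) => //; first exact: linear_funB.
  by move=> n; apply: sqrt_iter_comm.
Qed.
End ContractionSqrt.

(** * Contractivity of star-representations *)

Section CStarAlgebras.
Variables (R : realType) (A : cstarAlgType R).
Implicit Types a b : A.

Lemma star1 : star (1 : A) = 1.
Proof. by have := starM (star (1 : A)) 1; rewrite mulr1 starK mulr1 => <-. Qed.

Lemma starB a b : star (a - b) = star a - star b.
Proof. by rewrite -scaleN1r starD starZ rmorphN1 scaleN1r. Qed.

Lemma cstar_norm_ge0 a : 0 <= cstar_norm a.
Proof. exact: seminorm_ge0 (@cstar_normD _ A) (@cstar_normZ _ A) a. Qed.

Lemma cstar_norm_star a : cstar_norm (star a) = cstar_norm a.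
Proof.
have le b : cstar_norm b <= cstar_norm (star b).
  have [b0|b0] := leP (cstar_norm b) 0.
    exact: le_trans b0 (cstar_norm_ge0 _).
  rewrite -(ler_pM2r b0) -expr2 -cstar_identity; exact: cstar_normM.
by apply/le_anti; rewrite le andbT -{2}(starK a) le.
Qed.

(** The iteration is run on left multiplication by [b]. Its limit commutes with right
    multiplications, hence is left multiplication by [L 1], and [1 - L 1] is the root. *)
Lemma cstar_sqrt b : star b = b -> cstar_norm b <= 1 ->
  exists2 d, star d = d & d * d = 1 - b.
Proof.
move=> sb b1; pose X a := b * a.
have X_lin : linear X by move=> c x y; rewrite /X mulrDr scalerAr.
have X_le a : cstar_norm (X a) <= cstar_norm a.
  by apply: (le_trans (cstar_normM _ _)); rewrite ler_piMl // cstar_norm_ge0.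
have iterM n a : sqrt_iter X n a = sqrt_iter X n 1 * a.
  elim: n a => [|n IH] a /=; first by rewrite mul0r.
  by rewrite -scalerAl mulrDl IH (IH a) mulrA -IH /X mulr1.
have iter_star n : star (sqrt_iter X n 1) = sqrt_iter X n 1.
  elim: n => [|n IH] /=; first by rewrite -(subrr 1) starB star1.
  rewrite (iterM n (sqrt_iter X n 1)) starZ /X mulr1 starD starM IH sb.
  by rewrite fmorphV rmorph_nat.
have [L [_ _ L2 Lext Lcomm]] := contraction_sqrt (@cstar_norm_eq0 _ A)
  (@cstar_normD _ A) (@cstar_normZ _ A) (@cstar_complete _ A) X_lin X_le.
have LM a : L a = L 1 * a.
  rewrite -[in LHS](mul1r a); apply/esym/(Lcomm (fun x => x * a)).
  - by move=> c x y; rewrite mulrDl scalerAl.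
  - by exists (cstar_norm a) => x; rewrite mulrC cstar_normM.
  - by move=> x; rewrite /X mulrA.
have sL : star (L 1) = L 1.
  apply: (Lext _ 1) => //; first exact: starB.
  by move=> x; rewrite mul1r cstar_norm_star.
exists (1 - L 1); first by rewrite starB star1 sL.
have := L2 1; rewrite (LM (L 1)) /X mulr1 scaler_nat mulr2n => L2'.
have -> : (1 - L 1) * (1 - L 1) = 1 - L 1 + (L 1 * L 1 - L 1).
  by rewrite mulrBl mul1r mulrBr mulr1 opprB.
have -> : L 1 * L 1 = L 1 + L 1 - b by rewrite L2' addrAC subrr add0r.
by rewrite !addrA subrK addrAC addrK.
Qed.
End CStarAlgebras.

Section Contractivity.
Variables (R : realType) (A : cstarAlgType R) (H : hilbertType R).
Variables (rho : A -> {linear H -> H}) (hrho : star_representation rho).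

Lemma rep0 x : rho 0 x = 0.
Proof. by have := rep_lin hrho (-1) 0 0 x; rewrite !scaleN1r addNr addNr. Qed.

Lemma repD a b x : rho (a + b) x = rho a x + rho b x.
Proof. by have := rep_lin hrho 1 a b x; rewrite !scale1r. Qed.

Lemma repZ c a x : rho (c *: a) x = c *: rho a x.
Proof. by have := rep_lin hrho c a 0 x; rewrite rep0 !addr0. Qed.

Lemma repB a b x : rho (a - b) x = rho a x - rho b x.
Proof. by rewrite -scaleN1r repD repZ scaleN1r. Qed.

(** [rho 1] is a self-adjoint idempotent, that is, an orthogonal projection. *)
Lemma rep1_le x : dot (rho 1 x) (rho 1 x) <= dot x x.
Proof.
have r1 : dot x (rho 1 x) = dot (rho 1 x) (rho 1 x).
  by rewrite (rep_star hrho) star1 -(repM hrho) mulr1.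
have r2 : dot (rho 1 x) x = dot (rho 1 x) (rho 1 x).
  by rewrite (rep_star hrho) star1.
rewrite -subr_ge0.
have -> : dot x x - dot (rho 1 x) (rho 1 x) = dot (x - rho 1 x) (x - rho 1 x).
  by rewrite linearBl !linearBr /= r1 r2 subrr subr0.
exact: dnorm_ge0.
Qed.

(** If [d] is a self-adjoint root of [1 - star a * a], the squared norm of [rho a x] is that of
    [rho 1 x] minus that of [rho d x]. *)
Lemma rep_unit_ball a x : cstar_norm a <= 1 -> rnorm (rho a x) <= rnorm x.
Proof.
move=> a1.
have sb : star (star a * a) = star a * a by rewrite starM starK.
have [|d sd dd] := cstar_sqrt sb.
  by rewrite cstar_identity expr_le1 ?cstar_norm_ge0.
have : dot (rho a x) (rho a x) <= dot (rho 1 x) (rho 1 x).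
  have -> : dot (rho a x) (rho a x) =
      dot (rho 1 x) (rho 1 x) - dot (rho d x) (rho d x).
    rewrite !(rep_star hrho) star1 sd -!(repM hrho) mulr1 dd repB //.
    by rewrite linearBr /= opprB addrC subrK.
  by rewrite gerBl dnorm_ge0.
move=> /le_trans/(_ (rep1_le x)).
by rewrite -!sqr_rnorm lecR ler_sqr ?nnegrE ?rnorm_ge0.
Qed.

Lemma rep_contractive a x : rnorm (rho a x) <= cstar_norm a * rnorm x.
Proof.
have [a0|a0] := eqVneq (cstar_norm a) 0.
  by rewrite a0 mul0r (cstar_norm_eq0 _ a0) rep0 rnorm0.
set t := (cstar_norm a)^-1; have t0 : 0 <= t by rewrite invr_ge0 cstar_norm_ge0.
have ta : cstar_norm (t%:C *: a) = 1.
  by rewrite (seminormZ (@cstar_normZ _ A)) ger0_norm ?ler0c //= mulVf.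
have := @rep_unit_ball (t%:C *: a) x; rewrite ta => /(_ (lexx _)).
rewrite repZ // (seminormZ (@rnormZ _ H)) ger0_norm ?ler0c //=.
by rewrite mulrC ler_pdivrMr ?lt_def ?a0 ?cstar_norm_ge0 // mulrC.
Qed.
End Contractivity.

(** * Schur's lemma *)

Lemma dotC (R : realType) (H : hilbertType R) (x y : H) :
  dot x y = Num.conj (dot y x).
Proof. by rewrite hermC expr0 mul1r. Qed.

Lemma dotZl (R : realType) (H : hilbertType R) c (x y : H) :
  dot (c *: x) y = c * dot x y.
Proof. by rewrite linearZl_LR. Qed.

Lemma dotZr (R : realType) (H : hilbertType R) c (x y : H) :
  dot x (c *: y) = Num.conj c * dot x y.
Proof. by rewrite linearZr_LR. Qed.

Section Schur.
Variables (R : realType) (H : hilbertType R) (I : Type).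
Variable A : I -> {linear H -> H}.

Definition bounded_fun (F : H -> H) : Prop :=
  exists C, forall x, rnorm (F x) <= C * rnorm x.

(** Stated for an arbitrary family, so that it applies to the sixteen Fourier coefficients instead
    of the whole algebra. *)
Definition irreducible_family : Prop :=
  forall K : set H, closed_subspace K -> (forall v x, K x -> K (A v x)) ->
    K = [set 0]%classic \/ K = setT.

Let rnormZr c (x : H) : rnorm (c *: x) = complex.Re `|c| * rnorm x.
Proof. exact: seminormZ (@rnormZ _ H) c x. Qed.

Lemma rnormN (x : H) : rnorm (- x) = rnorm x.
Proof. by rewrite /rnorm normrN. Qed.

Lemma bounded_funD F G : bounded_fun F -> bounded_fun G ->
  bounded_fun (fun x => F x + G x).
Proof.
move=> [C FC] [D GD]; exists (C + D) => x; apply: (le_trans (rnormD _ _)).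
by rewrite mulrDl lerD.
Qed.

Lemma bounded_funZ c F : bounded_fun F -> bounded_fun (fun x => c *: F x).
Proof.
move=> [C FC]; exists (complex.Re `|c| * C) => x; rewrite rnormZr -mulrA.
by rewrite ler_wpM2l // -ler0c RRe_real // ger0_real.
Qed.

Lemma bounded_funB F G : bounded_fun F -> bounded_fun G ->
  bounded_fun (fun x => F x - G x).
Proof.
move=> Fb [D GD]; apply: bounded_funD => //.
by exists D => x; rewrite rnormN.
Qed.

Lemma bounded_fun_comp F G : bounded_fun F -> bounded_fun G ->
  bounded_fun (fun x => F (G x)).
Proof.
move=> [C FC] [D GD]; exists (`|C| * D) => x; apply: (le_trans (FC _)).
apply: le_trans (ler_wpM2r (rnorm_ge0 _) (ler_norm C)) _.
by rewrite -mulrA ler_wpM2l.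
Qed.

Lemma bounded_fun_id : bounded_fun id.
Proof. by exists 1 => x; rewrite mul1r. Qed.

Lemma closed_subspace_ker F : linear F -> bounded_fun F ->
  closed_subspace [set x | F x = 0]%classic.
Proof.
move=> Fl [C FC]; split.
- apply/closed_rnormP => x Fx /=; apply/rnorm0_eq0/le_anti.
  rewrite rnorm_ge0 andbT; apply/ler_addgt0Pr => e e0; rewrite add0r.
  have C0 : 0 < `|C| + 1 by rewrite ltr_wpDl.
  have [y /= Fy xy] := Fx _ (divr_gt0 e0 C0).
  rewrite -[F x]subr0 -Fy -(linear_funB Fl) (le_trans (FC _)) //.
  move: xy; rewrite ltr_pdivlMr //; have := ler_norm C.
  have := rnorm_ge0 (x - y); nra.
- exact: linear_fun0.
- by move=> c x y /= Fx Fy; rewrite Fl Fx Fy scaler0 addr0.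
Qed.

Hypothesis A_bounded : forall v, bounded_fun (A v).
Hypothesis A_irr : irreducible_family.

(** The kernel of an intertwiner is a closed invariant subspace. *)
Lemma irreducible_ker F : linear F -> bounded_fun F ->
  (forall v x, F (A v x) = A v (F x)) ->
  (forall x, F x = 0) \/ (forall x, F x = 0 -> x = 0).
Proof.
move=> Fl Fb FA.
have [|K0|KT] := A_irr (closed_subspace_ker Fl Fb).
- by move=> v x /= Fx; rewrite FA Fx linear0.
- by right=> x Fx; have : [set 0]%classic x by rewrite -K0.
- by left=> x; have : setT x by []; rewrite -KT.
Qed.

(* With Y = sqrt(T^2), the kernel of Y + T contains the range of Y - T, so by
   irreducibility T = Y or T = - Y, that is, T is definite. *)
Lemma definite_null_vector T x : linear T ->
  (forall x, rnorm (T x) <= rnorm x) ->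
  (forall x y, dot (T x) y = dot x (T y)) ->
  (forall v x, T (A v x) = A v (T x)) ->
  dot (T x) x = 0 -> T x = 0.
Proof.
move=> Tl T1 Ts TA Tx.
pose X y := y - T (T y).
have X_lin : linear X.
  exact: linear_fun_sub (@linear_fun_id _ _) (linear_fun_comp Tl Tl).
(* The squared norm of [y - T (T y)] is [|y|^2 - 2 |T y|^2 + |T (T y)|^2], and [T] is a
   contraction. *)
have X_le y : rnorm (X y) <= rnorm y.
  rewrite -ler_sqr ?nnegrE ?rnorm_ge0 // -lecR !sqr_rnorm /X.
  have TTy : dot y (T (T y)) = dot (T y) (T y) by rewrite Ts.
  rewrite linearBl !linearBr /= (Ts (T y)) TTy.
  rewrite -!sqr_rnorm -!rmorphB lecR.
  have := T1 y; have := T1 (T y); have := rnorm_ge0 (T y).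
  have := rnorm_ge0 (T (T y)); nra.
have [L [Ll L1 L2 _ Lcomm]] := contraction_sqrt (@rnorm0_eq0 _ H)
  (@rnormD _ H) (@rnormZ _ H) (@rnorm_complete _ H) X_lin X_le.
have LA v y : A v (L y) = L (A v y).
  apply: Lcomm; first exact: linearP.
  - exact: A_bounded.
  - by move=> w; rewrite linearB -!TA.
have LT y : T (L y) = L (T y).
  apply: (Lcomm T) => //; first by exists 1 => w; rewrite mul1r.
  by move=> w; rewrite (linear_funB Tl).
pose Y y := y - L y.
have Yl : linear Y by exact: linear_fun_sub (@linear_fun_id _ _) Ll.
have YY y : Y (Y y) = T (T y).
  have := L2 y; rewrite /Y (linear_funB Ll) /X scaler_nat mulr2n => L2'.
  have -> : y - L y - (L y - L (L y)) = y + L (L y) - (L y + L y).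
    by rewrite opprB opprD addrACA.
  by rewrite L2' opprD addrACA subrr addr0 subKr.
have YT y : T (Y y) = Y (T y) by rewrite /Y (linear_funB Tl) LT.
have Tb : bounded_fun T by exists 1 => w; rewrite mul1r.
have Lb : bounded_fun L by exists 1 => w; rewrite mul1r.
have Yb : bounded_fun Y by exact: bounded_funB bounded_fun_id Lb.
have Yx : dot (Y x) x = 0.
  have [|||FT|F0] := @irreducible_ker (fun y => Y y + T y).
  - exact: linear_fun_add.
  - exact: bounded_funD.
  - by move=> v y; rewrite linearD TA /Y linearB LA.
  - by rewrite -[Y x](addrK (T x)) FT sub0r linearNl /= Tx oppr0.
  - suff -> : Y x = T x by [].
    apply/eqP; rewrite -subr_eq0; apply/eqP/F0.
    by rewrite (linear_funB Yl) (linear_funB Tl) YY YT addrA subrK subrr.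
(* Since [Y = 1 - L], a vanishing [dot (Y x) x] gives [|Y x|^2 = |L x|^2 - |x|^2], which is at most
   0. *)
have Lx : dot (L x) x = dot x x.
  by apply/esym/eqP; rewrite -subr_eq0 -Yx linearBl.
have xL : dot x (L x) = dot x x.
  by rewrite dotC Lx -dotC.
have Yx0 : Y x = 0.
  have le0 : dot (Y x) (Y x) <= 0.
    rewrite /Y linearBl !linearBr /= Lx xL subrr sub0r opprB subr_le0.
    by rewrite -!sqr_rnorm lecR ler_sqr ?nnegrE ?rnorm_ge0.
  by apply/eqP; rewrite -(dnorm_eq0 dot) eq_le le0 dnorm_ge0.
have : dot (T x) (T x) = 0 by rewrite Ts -YY Yx0 (linear_fun0 Yl) linear0r.
by move/eqP; rewrite dnorm_eq0 => /eqP.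
Qed.

(** Take [c] to be the Rayleigh quotient of [T] at a nonzero [x]. The form of [T - c] vanishes at
    [x], so [definite_null_vector], applied after scaling to a contraction, puts [x] in the kernel
    of [T - c]; an intertwiner with nonzero kernel is zero. *)
Lemma schur T : linear T -> bounded_fun T ->
  (forall x y, dot (T x) y = dot x (T y)) ->
  (forall v x, T (A v x) = A v (T x)) ->
  exists c, forall x, T x = c *: x.
Proof.
move=> Tl [C TC] Ts TA.
have [[x x0]|Hx0] := pselect (exists x : H, x != 0); last first.
  exists 0 => x; suff -> : x = 0 by rewrite (linear_fun0 Tl) scaler0.
  by apply/eqP/negPn/negP => x0; apply: Hx0; exists x.
have xx0 : dot x x != 0 by rewrite dnorm_eq0.
pose c := dot (T x) x / dot x x; exists c.
have cR : Num.conj c = c.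
  by rewrite /c rmorphM fmorphV /= -!dotC Ts.
have c_le : 0 <= complex.Re `|c| by rewrite -ler0c RRe_real // ger0_real.
pose M := `|C| + complex.Re `|c| + 1.
have M0 : 0 < M by rewrite /M ltr_wpDl // addr_ge0.
pose S y := (M^-1)%:C *: (T y - c *: y).
have Mc : Num.conj (M^-1)%:C = (M^-1)%:C.
  by rewrite conj_Creal // ger0_real // ler0c invr_ge0 ltW.
have Sl : linear S.
  apply: linear_funZr; apply: linear_fun_sub => //.
  exact: linear_funZr (@linear_fun_id _ _).
have SA v y : S (A v y) = A v (S y).
  have Al : linear (A v) by exact: linearP.
  by rewrite /S TA (linear_funZ Al) (linear_funB Al) (linear_funZ Al).
have Sx : S x = 0.
  apply: definite_null_vector => //.
  - move=> y; rewrite /S rnormZr ger0_norm ?ler0c ?invr_ge0 ?(ltW M0) //=.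
    rewrite ler_pdivrMl //; apply: (le_trans (rnormD _ _)).
    rewrite rnormN rnormZr; have := TC y; have := rnorm_ge0 y.
    have := ler_wpM2r (rnorm_ge0 y) (ler_norm C); rewrite /M; nra.
  - move=> y z; rewrite /S linearZl_LR linearZr_LR /= Mc; congr (_ * _).
    by rewrite linearBl linearBr /= Ts linearZl_LR linearZr_LR /= cR.
  - rewrite /S linearZl_LR linearBl /= linearZl_LR /= /c divfK //.
    by rewrite subrr mulr0.
have [|||S0|/(_ x Sx) x0'] := @irreducible_ker S.
- exact: Sl.
- apply: bounded_funZ; apply: bounded_funB; first by exists C.
  exact: bounded_funZ bounded_fun_id.
- exact: SA.
- move=> y; have /eqP := S0 y; rewrite scaler_eq0 subr_eq0 => /orP[|/eqP //].
  by rewrite fmorph_eq0 invr_eq0 gt_eqF.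
- by rewrite x0' eqxx in x0.
Qed.
End Schur.

(** * Irreducible families with Pauli commutation relations *)

Section Frame.
Variables (R : realType) (H : hilbertType R) (J : Type).
Variable A : J -> {linear H -> H}.
Hypothesis A_irr : irreducible_family A.

(** The span of the [e i] is the kernel of [F], the projection onto its orthogonal complement. It is
    closed, invariant and contains [e i0], so it is all of [H]. *)
Lemma has_dim_orthonormal (I : finType) (e : I -> H) (i0 : I) :
  (forall i j, dot (e i) (e j) = (i == j)%:R) ->
  (forall v i, exists c j, A v (e i) = c *: e j) -> has_dim H #|I|.
Proof.
move=> e_on Ae.
pose P x := \sum_i dot x (e i) *: e i.
pose F x := x - P x.
have dot_sum (c : I -> R[i]) j : dot (\sum_i c i *: e i) (e j) = c j.
  rewrite linear_sumlz (bigD1 j) //= big1 ?addr0 => [|i ij].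
    by rewrite linearZl_LR /= e_on eqxx mulr1.
  by rewrite linearZl_LR /= e_on (negPf ij) mulr0.
have Pl : linear P.
  move=> c x y; rewrite /P scaler_sumr -big_split; apply: eq_bigr => i _.
  by rewrite /= linearPl /= scalerDl scalerA.
have Fl : linear F by exact: linear_fun_sub (@linear_fun_id _ _) Pl.
have FP x y : dot (F x) (P y) = 0.
  rewrite linear_sumr big1 // => i _; rewrite linearZr_LR /= /F.
  by rewrite linearBl /= dot_sum subrr mulr0.
have Fb : bounded_fun F.
  exists 1 => x; rewrite mul1r -ler_sqr ?nnegrE ?rnorm_ge0 // -lecR !sqr_rnorm.
  by have := hnormDd (FP x x); rewrite subrK => ->; rewrite lerDl dnorm_ge0.
have Fe i : F (e i) = 0.
  rewrite /F /P (bigD1 i) //= e_on eqxx scale1r big1 ?addr0 ?subrr // => j ji.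
  by rewrite e_on eq_sym (negPf ji) scale0r.
have clF := closed_subspace_ker Fl Fb.
have F0 x : F x = 0.
  have [v y /= Fy|FK|FT] := A_irr clF.
  - rewrite -(subrK (P y) y) -/(F y) Fy add0r /P linear_sum.
    elim/big_rec: _ => [|i z _ Fz]; first exact: linear_fun0.
    have [c [j cj]] := Ae v i.
    by rewrite linearZ /= cj Fl Fz (linear_funZ Fl) Fe !scaler0 addr0.
  - have : [set 0]%classic (e i0) by rewrite -FK; exact: Fe.
    move=> /= ei; have := e_on i0 i0; rewrite ei linear0l eqxx.
    by move/esym/eqP; rewrite oner_eq0.
  - by have : setT x by []; rewrite -FT.
constructor; exists (fun x => \row_i dot x (e (enum_val i))).
  by move=> c x y; apply/rowP => i; rewrite !mxE linearPl.
exists (fun r : 'rV_#|I| => \sum_i r 0 (enum_rank i) *: e i) => [x|r].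
  have /eqP := F0 x; rewrite subr_eq0 => /eqP {2}->.
  by apply: eq_bigr => i _; rewrite mxE enum_rankK.
by apply/rowP => i; rewrite mxE dot_sum enum_valK.
Qed.
End Frame.

(* The commutation form of Pauli matrices: sigma_p and sigma_q anticommute iff
   [omega p q]. Both the indices and the exponents of signs live in F_2, encoded
   as [bool] with its additive structure [addb]. *)
Definition omega (p q : bool * bool) : bool :=
  (p.1 && q.2) (+) (p.2 && q.1).

Definition Omega (v w : (bool * bool) * (bool * bool)) : bool :=
  omega v.1 w.1 (+) omega v.2 w.2.

Lemma omegaDl p q r : omega (p + q) r = omega p r (+) omega q r.
Proof. by case: p q r => [[] []] [[] []] [[] []]. Qed.

Lemma omegaC p q : omega p q = omega q p.
Proof. by case: p q => [[] []] [[] []]. Qed.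

Lemma OmegaDl u v w : Omega (u + v) w = Omega u w (+) Omega v w.
Proof. by rewrite /Omega !omegaDl addbACA. Qed.

Lemma OmegaC v w : Omega v w = Omega w v.
Proof. by rewrite /Omega omegaC (omegaC v.2). Qed.

Lemma OmegaDr u v w : Omega w (u + v) = Omega w u (+) Omega w v.
Proof. by rewrite OmegaC OmegaDl !(OmegaC w). Qed.

Lemma Omega0l w : Omega 0 w = false.
Proof. by case: w => [[[] []] [[] []]]. Qed.

Lemma Omega0r w : Omega w 0 = false.
Proof. by rewrite OmegaC Omega0l. Qed.

Lemma Omega_diag v : Omega v v = false.
Proof. by case: v => [[[] []] [[] []]]. Qed.

(** Two mutually orthogonal hyperbolic pairs form a basis of F_2^4, and pairing with the partner of
    a basis vector reads off its coordinate. *)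
Lemma Omega_symplectic_basis a b c d v :
  Omega a b -> Omega c d ->
  ~~ Omega a c -> ~~ Omega a d -> ~~ Omega b c -> ~~ Omega b d ->
  v = (if Omega v a then b else 0) + (if Omega v c then d else 0)
    + ((if Omega v b then a else 0) + (if Omega v d then c else 0)).
Proof.
pose q := [:: (false, false); (false, true); (true, false); (true, true)].
pose Vs := [seq (x, y) | x <- q, y <- q].
have inVs w : w \in Vs by case: w => [[[] []] [[] []]].
(* Each hypothesis is tested as soon as its vectors are chosen, so the innermost loop only runs over
   symplectic bases. *)
pose test := all (fun a => all (fun b => if ~~ Omega a b then true else
  all (fun c => if Omega a c || Omega b c then true else
  all (fun d => if ~~ Omega c d || Omega a d || Omega b d then true else
  all (fun v => v == (if Omega v a then b else 0) + (if Omega v c then d else 0)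
    + ((if Omega v b then a else 0) + (if Omega v d then c else 0))) Vs)
  Vs) Vs) Vs) Vs.
have /allP/(_ a (inVs a))/allP/(_ b (inVs b)) : test by vm_compute.
move=> + ab cd ac ad bc bd; rewrite ab; lazy beta iota delta [negb orb].
move=> /allP/(_ c (inVs c)); rewrite (negPf ac) (negPf bc).
lazy beta iota delta [negb orb].
move=> /allP/(_ d (inVs d)); rewrite cd (negPf ad) (negPf bd).
lazy beta iota delta [negb orb].
by move=> /allP/(_ v (inVs v))/eqP.
Qed.

(** * Words in a Pauli family and the frames they generate *)

Section PauliFamily.
Variables (R : realType) (H : hilbertType R).
Let V := ((bool * bool) * (bool * bool))%type.
Implicit Types (v w : V) (s t : seq V) (x y : H).
Variable A : V -> {linear H -> H}.
Hypothesis A_bounded : forall v, bounded_fun (A v).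
Hypothesis A_star : forall v x y, dot (A v x) y = dot x (A v y).
Hypothesis A_comm : forall v w x,
  A v (A w x) = (-1) ^+ Omega v w *: A w (A v x).
Hypothesis A_irr : irreducible_family A.
Hypothesis H_nontrivial : exists x : H, x != 0.

Let conj_signM (b : bool) (z : R[i]) :
  Num.conj ((-1) ^+ b * z) = (-1) ^+ b * Num.conj z.
Proof. by rewrite rmorphM rmorph_sign. Qed.

(** The signs cancel in the commutation of [A v] squared with any [A w], so by Schur this square is
    a scalar [c]. As [|A v x|^2 = c |x|^2], [c] is nonnegative, and [A v] vanishes when [c] does. *)
Lemma pauli_scale : exists k : V -> R[i], forall v,
  [/\ Num.conj (k v) = k v, forall x, A v (A v x) = k v ^+ 2 *: x &
      k v = 0 -> forall x, A v x = 0].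
Proof.
suff h v : exists k : R[i], [/\ Num.conj k = k,
    forall x, A v (A v x) = k ^+ 2 *: x & k = 0 -> forall x, A v x = 0].
  by have [k kP] := choice h; exists k.
have [|||w x|c cP] := @schur _ _ _ A A_bounded A_irr (fun x => A v (A v x)).
- exact: linear_fun_comp (linearP _) (linearP _).
- exact: bounded_fun_comp.
- by move=> x y; rewrite !A_star.
- rewrite (A_comm v w x) linearZ /= (A_comm v w) scalerA -expr2 sqrr_sign.
  by rewrite scale1r.
have AA x : dot (A v x) (A v x) = c * dot x x.
  by rewrite A_star -linearZl_LR /= -cP A_star.
have c0 : 0 <= c.
  have [x x0] := H_nontrivial.
  rewrite -(pmulr_lge0 _ (_ : 0 < dot x x)) ?dnorm_gt0 // -AA.
  exact: dnorm_ge0.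
exists (sqrtC c); split.
- by rewrite conj_Creal // ger0_real // sqrtC_ge0.
- by move=> x; rewrite sqrtCK.
- move/eqP; rewrite sqrtC_eq0 => /eqP c00 x.
  by apply/eqP; rewrite -(dnorm_eq0 dot) AA c00 mul0r.
Qed.

Let k := sval (cid pauli_scale).
Let kP v : [/\ Num.conj (k v) = k v, forall x, A v (A v x) = k v ^+ 2 *: x &
  k v = 0 -> forall x, A v x = 0].
Proof. exact: (svalP (cid pauli_scale)). Qed.

(** For [k v = 0] the inverse is 0 and [U v] is the zero map, which keeps [AU] valid for all [v]; if
    [D v] holds, [U v] is a self-adjoint unitary. *)
Let U v x := (k v)^-1 *: A v x.
Let D v := k v != 0.

Let AU v x : A v x = k v *: U v x.
Proof.
rewrite /U scalerA; have [kv|kv] := eqVneq (k v) 0.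
  by have [_ _ ->] := kP v; rewrite ?scaler0.
by rewrite divff // scale1r.
Qed.

Let A_lin v : linear (A v).
Proof. exact: linearP. Qed.

Let U_lin v : linear (U v).
Proof. exact: linear_funZr. Qed.

Let UA v w x : U v (A w x) = (-1) ^+ Omega v w *: A w (U v x).
Proof. by rewrite /U A_comm (linear_funZ (A_lin w)) !scalerA mulrC. Qed.

Let UK v : D v -> involutive (U v).
Proof.
move=> kv x; rewrite /U linearZ /= scalerA.
have [_ -> _] := kP v; rewrite scalerA -expr2 exprVn mulVf ?scale1r //.
by rewrite expf_neq0.
Qed.

Let U_iso v x y : D v -> dot (U v x) (U v y) = dot x y.
Proof.
move=> kv; have [kR _ _] := kP v.
have -> : dot (U v x) (U v y) = dot x (U v (U v y)).
  rewrite [U v x]/U dotZl A_star [U v (U v y)]/U dotZr; congr (_ * _).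
  by rewrite fmorphV; congr (_^-1); rewrite [RHS]kR.
by rewrite UK.
Qed.

(** Words encode monomials in the [U v]; their class [tau] in F_2^4 determines all commutation
    signs. *)
Let op s x := foldr U x s.
Let word s := all D s.
Let tau s : V := \sum_(v <- s) v.

Let op_cat s t x : op (s ++ t) x = op s (op t x).
Proof. exact: foldr_cat. Qed.

Let op_lin s : linear (op s).
Proof. by elim: s => //= v s IH; exact: linear_fun_comp. Qed.

Let tau_cons v s : tau (v :: s) = v + tau s.
Proof. exact: big_cons. Qed.

Let tau_cat s t : tau (s ++ t) = tau s + tau t.
Proof. exact: big_cat. Qed.

Let op_A s w x : op s (A w x) = (-1) ^+ Omega (tau s) w *: A w (op s x).
Proof.
elim: s => [|v s IH] /=; first by rewrite /tau big_nil Omega0l scale1r.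
by rewrite IH linear_funZ // UA scalerA tau_cons OmegaDl signr_addb mulrC.
Qed.

Let op_op s t x :
  op s (op t x) = (-1) ^+ Omega (tau s) (tau t) *: op t (op s x).
Proof.
elim: t => [|w t IH] /=.
  by rewrite /tau big_nil Omega0r scale1r.
rewrite {1}/U (linear_funZ (op_lin s)) op_A IH (linear_funZ (A_lin w)).
by rewrite tau_cons OmegaDr signr_addb /U !scalerA; congr (_ *: _); ring.
Qed.

Let op_rev s : word s -> cancel (op (rev s)) (op s).
Proof.
elim: s => //= v s IH /andP[Dv ws] x.
by rewrite rev_cons -cats1 op_cat /= IH // UK.
Qed.

Let op_sqr s : word s ->
  exists b : bool, forall x, op s (op s x) = (-1) ^+ b *: x.
Proof.
elim: s => [_|v s IH /andP[Dv ws]] /=.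
  by exists false => x; rewrite scale1r.
have [b bP] := IH ws; exists (Omega (tau s) v (+) b) => x.
have := op_op s [:: v] (op s x); rewrite /= /tau big_seq1 -/(tau s) => ->.
by rewrite linear_funZ // UK // bP scalerA signr_addb.
Qed.

Let op_iso s x y : word s -> dot (op s x) (op s y) = dot x y.
Proof.
by elim: s => //= v s IH /andP[Dv ws]; rewrite U_iso // IH.
Qed.

Let op_bounded s : bounded_fun (op s).
Proof.
elim: s => [|v s IH] /=; first exact: bounded_fun_id.
by apply: bounded_fun_comp => //; exact: bounded_funZ.
Qed.

(** [op s] commutes with the family and squares to [l * l], but need not be self-adjoint. Instead of
    Schur, use [(op s - l) (op s + l) = 0]: either the first factor is zero, or it is injective and
    the second is zero. *)
Let radical_scalar s : word s -> (forall w, D w -> Omega (tau s) w = false) ->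
  exists c, forall x, op s x = c *: x.
Proof.
move=> ws rad; have [b bP] := op_sqr ws.
pose l : R[i] := sqrtC ((-1) ^+ b).
have ll : l * l = (-1) ^+ b by rewrite -expr2 sqrtCK.
have Fl : linear (fun x => op s x - l *: x).
  apply: linear_fun_sub => //; exact: linear_funZr (@linear_fun_id _ _).
have [||F0|Fi] := irreducible_ker A_irr Fl.
- exact: (bounded_funB (op_bounded s) (bounded_funZ l (@bounded_fun_id _ _))).
- move=> w x; rewrite /= op_A (linear_funB (A_lin w)) (linear_funZ (A_lin w)).
  congr (_ - _).
  have [kw|/rad->] := eqVneq (k w) 0; last by rewrite scale1r.
  by have [_ _ ->] := kP w; rewrite ?scaler0.
- by exists l => x; apply/eqP; rewrite -subr_eq0 F0.
- exists (- l) => x; apply/eqP; rewrite scaleNr -addr_eq0; apply/eqP/Fi.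
  rewrite (linear_funD (op_lin s)) bP (linear_funZ (op_lin s)) scalerDr.
  by rewrite scalerA ll [X in X - _]addrC subrr.
Qed.

(** In characteristic 2 the word [s ++ rev t] is radical, and [rev t] inverts [t]. *)
Let op_congr s t : word s -> word t ->
  (forall w, D w -> Omega (tau s) w = Omega (tau t) w) ->
  exists c, forall x, op s x = c *: op t x.
Proof.
move=> ws wt st.
have [|w Dw|c cP] := @radical_scalar (s ++ rev t).
- by rewrite /word all_cat all_rev; apply/andP.
- have -> : tau (s ++ rev t) = tau s + tau t.
    by rewrite tau_cat; congr (_ + _); apply: perm_big; rewrite perm_rev.
  by rewrite OmegaDl st // addbb.
exists c => x; rewrite -cP op_cat; congr (op s _).
by have := @op_rev (rev t); rewrite revK /word all_rev => ->.
Qed.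

(* The basis is given by the [op (B i) x]: the words a separate its vectors as
   joint eigenvectors, and modulo radical words every word is some [B j] followed
   by a word that has x as eigenvector. *)
Lemma has_dim_frame (I : finType) (B : I -> seq V) (x : H) (i0 : I) :
  x != 0 -> (forall i, word (B i)) ->
  (forall i j, i != j -> exists a l, [/\ word a, op a x = l *: x &
     Omega (tau a) (tau (B i)) != Omega (tau a) (tau (B j))]) ->
  (forall s, word s -> exists j a l, [/\ word a, op a x = l *: x &
     forall w, D w -> Omega (tau s) w = Omega (tau (B j ++ a)) w]) ->
  has_dim H #|I|.
Proof.
move=> x0 wB sep cov.
wlog x1 : x x0 sep cov / dot x x = 1.
  move=> wl; pose c := (sqrtC (dot x x))^-1.
  have xx : 0 < dot x x by rewrite dnorm_gt0.
  have c0 : c != 0 by rewrite invr_eq0 sqrtC_eq0 gt_eqF.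
  apply: (wl (c *: x)).
  - by rewrite scaler_eq0 negb_or c0.
  - move=> i j /sep[a [l [wa ax ne]]]; exists a, l; split => //.
    by rewrite (linear_funZ (op_lin a)) ax !scalerA mulrC.
  - move=> s /cov[j [a [l [wa ax ne]]]]; exists j, a, l; split => //.
    by rewrite (linear_funZ (op_lin a)) ax !scalerA mulrC.
  - rewrite dnormZ ger0_norm ?invr_ge0 ?sqrtC_ge0 ?ltW //.
    by rewrite exprVn sqrtCK mulVf // gt_eqF.
apply: (@has_dim_orthonormal _ _ _ A A_irr I (fun i => op (B i) x) i0).
  move=> i j; have [->|/sep[a [l [wa ax ne]]]] := eqVneq i j.
    by rewrite op_iso.
  (* The isometry [op a] has opposite eigenvalues, of modulus 1, on the two vectors; hence their
     inner product equals its own negative. *)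
  have ll : l * Num.conj l = 1.
    have := op_iso x x wa; by rewrite ax dotZl dotZr x1 mulr1.
  have := op_iso (op (B i) x) (op (B j) x) wa.
  rewrite !(op_op a) ax !(linear_funZ (op_lin _)) !scalerA.
  rewrite dotZl dotZr conj_signM mulrA mulrACA ll mulr1.
  rewrite -signr_addb.
  have -> : Omega (tau a) (tau (B i)) (+) Omega (tau a) (tau (B j)) = true.
    by case: Omega ne => /=; case: Omega.
  rewrite expr1 mulN1r => /eqP; rewrite eq_sym -addr_eq0 -mulr2n mulrn_eq0.
  by move=> /eqP.
(* Up to a scalar, [A v] prepends the letter [v] to the word [B i], and the covering hypothesis
   rewrites the result as a multiple of a basis vector. *)
move=> v i; have [kv|kv] := eqVneq (k v) 0.
  by exists 0, i0; have [_ _ ->] := kP v; rewrite ?scale0r.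
have wv : word (v :: B i) by apply/andP; split; [exact: kv | exact: wB].
have [j [a [l [wa ax E]]]] := cov _ wv.
have [|c cP] := op_congr wv _ E.
  by rewrite /word all_cat; apply/andP; split; [exact: wB | exact: wa].
exists (k v * (c * l)), j.
have := cP x; rewrite op_cat ax (linear_funZ (op_lin _)) scalerA /= => h.
by rewrite AU h scalerA.
Qed.

(** Since [op a] squares to [l * l], [op a y + l y] is an eigenvector unless it is zero; in that
    case [y] has eigenvalue [- l], and the anticommuting [op b] flips the sign. The last clause
    preserves eigenvalues obtained from an orthogonal pair. *)
Let eigenvector a b : word a -> word b -> Omega (tau a) (tau b) ->
  exists l, forall y, y != 0 -> exists x, [/\ x != 0, op a x = l *: x &
    forall c m, Omega (tau c) (tau a) = false -> Omega (tau c) (tau b) = false ->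
      op c y = m *: y -> op c x = m *: x].
Proof.
move=> wa wb ab; have [e eP] := op_sqr wa.
pose l : R[i] := sqrtC ((-1) ^+ e).
have ll : l * l = (-1) ^+ e by rewrite -expr2 sqrtCK.
exists l => y y0.
have [z0|z0] := eqVneq (op a y + l *: y) 0; last first.
  exists (op a y + l *: y); split => //.
    rewrite (linear_funD (op_lin a)) eP (linear_funZ (op_lin a)) scalerDr.
    by rewrite scalerA ll addrC.
  move=> c m ca _ cy; rewrite (linear_funD (op_lin c)) (linear_funZ (op_lin c)).
  rewrite op_op ca scale1r cy (linear_funZ (op_lin a)) scalerDr.
  by rewrite !scalerA mulrC.
exists (op b y); split.
- apply: contraNneq y0 => by0; rewrite -(dnorm_eq0 dot) -(op_iso y y wb) by0.
  by rewrite linear0l.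
- rewrite op_op ab expr1 scaleN1r.
  move/eqP: z0; rewrite addr_eq0 => /eqP ->.
  by rewrite -scaleNr (linear_funZ (op_lin b)) scaleNr opprK.
- by move=> c m _ cb cy; rewrite op_op cb scale1r cy (linear_funZ (op_lin b)).
Qed.

Let wordif (b : bool) s : word s -> word (if b then s else [::]).
Proof. by case: b. Qed.

Let tau_if (b : bool) s : tau (if b then s else [::]) = if b then tau s else 0.
Proof. by case: b => //; rewrite /tau big_nil. Qed.

Let op_if (b : bool) s x l : op s x = l *: x ->
  op (if b then s else [::]) x = (if b then l else 1) *: x.
Proof. by case: b => //; rewrite scale1r. Qed.

(** Symplectic Gram-Schmidt on the classes of words: the cases are zero, one or two hyperbolic
    pairs. *)
Lemma pauli_dim : has_dim H 1 \/ has_dim H 2 \/ has_dim H 4.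
Proof.
have tau1 w : tau [:: w] = w by exact: big_seq1.
have w1 w : D w -> word [:: w] by rewrite /word /= andbT.
have [y y0] := H_nontrivial.
have [[a [b [wa wb ab]]]|comm] := pselect (exists a b,
    [/\ word a, word b & Omega (tau a) (tau b)]); last first.
  left; rewrite -card_unit.
  apply: (@has_dim_frame _ (fun=> [::]) y tt) => // s ws.
  exists tt, [::], 1; split; [by [] | by rewrite scale1r | move=> w Dw].
  rewrite /tau big_nil Omega0l -/(tau s) -(tau1 w).
  by apply/negP => sw; apply: comm; exists s, [:: w]; split => //; apply: w1.
right.
have ba : Omega (tau b) (tau a) by rewrite OmegaC.
have aa := Omega_diag (tau a); have bb := Omega_diag (tau b).
(* [red s] is the symplectic projection of s onto the orthogonal of a and b. *)
pose red s := s ++ (if Omega (tau s) (tau a) then b else [::])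
                ++ (if Omega (tau s) (tau b) then a else [::]).
have wred s : word s -> word (red s).
  by move=> ws; rewrite /word !all_cat; apply/and3P; split => //; exact: wordif.
have tau_red s : tau (red s) = tau s
    + ((if Omega (tau s) (tau a) then tau b else 0)
     + (if Omega (tau s) (tau b) then tau a else 0)).
  by rewrite !tau_cat !tau_if.
have reda s : Omega (tau (red s)) (tau a) = false.
  rewrite tau_red !OmegaDl; case: (Omega (tau s) _); case: (Omega (tau s) _);
  by rewrite ?Omega0l ?aa ?ba.
have redb s : Omega (tau (red s)) (tau b) = false.
  rewrite tau_red !OmegaDl; case: (Omega (tau s) _); case: (Omega (tau s) _);
  by rewrite ?Omega0l ?bb ?ab.
have [la eiga] := eigenvector wa wb ab.
have [x [x0 ax xc]] := eiga y y0.
have [[s [t [ws wt cd]]]|comm] := pselect (exists s t,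
    [/\ word s, word t & Omega (tau (red s)) (tau (red t))]); last first.
  left; rewrite -card_bool.
  apply: (@has_dim_frame _ (fun i : bool => if i then b else [::]) x true) => //.
  - by move=> i; exact: wordif.
  - move=> i j ij; exists a, la; split => //.
    rewrite !tau_if; case: i j ij => [] [] //= _;
    by rewrite ab Omega0r.
  - move=> s ws.
    (* These are the coordinates of [s] along [b] and [a]; what remains of [s] is [red s], shown to
       be radical. *)
    exists (Omega (tau s) (tau a)), (if Omega (tau s) (tau b) then a else [::]).
    eexists; split; [exact: wordif | exact: op_if ax | move=> w Dw].
    rewrite tau_cat !tau_if.
    (* [red [:: w]] differs from [w] by a combination of [a] and [b], to which [red s] is
       orthogonal. *)
    have rw : Omega (tau (red s)) w = false.
      have <- : Omega (tau (red s)) (tau (red [:: w])) = Omega (tau (red s)) w.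
        rewrite [tau (red [:: w])]tau_red !OmegaDr tau1.
        by case: (Omega w _); case: (Omega w _);
          rewrite ?reda ?redb ?Omega0r ?addbF.
      by apply/negP => sw; apply: comm; exists s, [:: w]; split => //; apply: w1.
    by apply/eqP; move: rw; rewrite tau_red OmegaDl => /negbT; rewrite negb_add.
right; have -> : 4%N = #|{: bool * bool}| by rewrite card_prod card_bool.
set c := red s in cd *; set d := red t in cd *.
have wc : word c by exact: wred. have wd : word d by exact: wred.
have [lc eigc] := eigenvector wc wd cd.
have [z [z0 cz zc]] := eigc x x0.
have ac : Omega (tau a) (tau c) = false by rewrite OmegaC reda.
have ad : Omega (tau a) (tau d) = false by rewrite OmegaC reda.
have cb : Omega (tau c) (tau b) = false by exact: redb.
have db : Omega (tau d) (tau b) = false by exact: redb.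
clearbody c d.
(* [z] is now a joint eigenvector of [a] and [c]; the partners [b] and [d] move it to four vectors
   told apart by those eigenvalues. *)
have az := zc a la ac ad ax.
apply: (@has_dim_frame _ (fun i : bool * bool => (if i.1 then b else [::]) ++
  (if i.2 then d else [::])) z (true, true)) => //.
- by move=> i; rewrite /word all_cat; apply/andP; split; exact: wordif.
- move=> [i1 i2] [j1 j2]; rewrite xpair_eqE negb_and /=.
  have Ob (e : bool) g : Omega g (if e then tau b else 0) = e && Omega g (tau b).
    by case: e; rewrite //= Omega0r.
  have Od (e : bool) g : Omega g (if e then tau d else 0) = e && Omega g (tau d).
    by case: e; rewrite //= Omega0r.
  move=> /orP[ij|ij]; [exists a, la | exists c, lc]; split => //;
    rewrite !tau_cat !tau_if !OmegaDr !Ob !Od.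
  - by rewrite ab ad !andbF !addbF !andbT.
  - by rewrite cb cd !andbF !addFb !andbT.
- move=> u wu.
  exists (Omega (tau u) (tau a), Omega (tau u) (tau c)).
  exists ((if Omega (tau u) (tau b) then a else [::]) ++
          (if Omega (tau u) (tau d) then c else [::])).
  eexists; split.
  + by rewrite /word all_cat; apply/andP; split; exact: wordif.
  + by rewrite op_cat (op_if _ cz) (linear_funZ (op_lin _)) (op_if _ az) scalerA.
  (* Two hyperbolic pairs exhaust F_2^4, so the classes are equal, with no radical part left
     over. *)
  + move=> w _; rewrite !tau_cat !tau_if; congr Omega.
    by apply: Omega_symplectic_basis => //; rewrite ?ac ?ad // OmegaC ?cb ?db.
Qed.
End PauliFamily.

(** * Fourier transform of a magic unitary of order four *)

Section Fourier.
Variables (R : realType) (B : algType R[i]).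
Let T := (bool * bool)%type.
Implicit Types (i j k l m p q : T) (v : T -> T -> B).

Definition klein_char p q : R[i] := (-1) ^+ ((p.1 && q.1) (+) (p.2 && q.2)).
Local Notation chi := klein_char.

Lemma klein_charC p q : chi p q = chi q p.
Proof. by rewrite /chi andbC [p.2 && _]andbC. Qed.

Lemma klein_charDl p q k : chi (p + q) k = chi p k * chi q k.
Proof.
rewrite /chi -signr_addb; congr (_ ^+ nat_of_bool _).
by case: p q k => [[] []] [[] []] [[] []].
Qed.

Lemma big_klein (V : nmodType) (F : T -> V) :
  \sum_p F p = F (true, true) + F (true, false)
    + (F (false, true) + F (false, false)).
Proof.
rewrite (eq_bigr (fun p => F (p.1, p.2))) => [|[]//].
by rewrite -(pair_bigA _ (fun a b => F (a, b))) /= !big_bool.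
Qed.

Lemma klein_char_ortho k l : \sum_p chi p k * chi p l = (k == l)%:R * 4.
Proof.
rewrite big_klein /chi; case: k l => [[] []] [[] []] /=; rewrite ?expr0 ?expr1;
ring.
Qed.

Lemma sum_klein_char j : \sum_l chi j l = (j == 0)%:R * 4.
Proof.
by rewrite -klein_char_ortho; apply: eq_bigr => l _; rewrite !(klein_charC l)
  [chi 0 l]/chi expr0 mulr1.
Qed.

(** The factor 1/4 is the unitary normalisation for a group of order 16, so the transform is its own
    inverse. *)
Definition klein_fourier v i j : B :=
  4^-1 *: \sum_k \sum_l (chi i k * chi j l) *: v k l.

Lemma klein_fourierT v i j :
  klein_fourier (fun k l => v l k) i j = klein_fourier v j i.
Proof.
rewrite /klein_fourier exchange_big /=; congr (_ *: _).
by apply: eq_bigr => k _; apply: eq_bigr => l _; rewrite mulrC.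
Qed.

Lemma klein_fourierE v i j :
  klein_fourier v i j = 4^-1 *: \sum_k chi i k *: \sum_l chi j l *: v k l.
Proof.
congr (_ *: _); apply: eq_bigr => k _; rewrite scaler_sumr.
by apply: eq_bigr => l _; rewrite scalerA.
Qed.

Lemma klein_char_inversion (F : T -> B) k :
  \sum_i chi i k *: (\sum_p chi i p *: F p) = 4 *: F k.
Proof.
transitivity (\sum_p \sum_i (chi i k * chi i p) *: F p).
  rewrite exchange_big; apply: eq_bigr => i _; rewrite scaler_sumr.
  by apply: eq_bigr => p _; rewrite scalerA.
rewrite (bigD1 k) //= [X in _ + X]big1 ?addr0 => [|p pk];
  rewrite -scaler_suml klein_char_ortho; first by rewrite eqxx mul1r.
by rewrite eq_sym (negPf pk) mul0r scale0r.
Qed.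

Lemma klein_fourierK v k l :
  v k l = 4^-1 *: \sum_i \sum_j (chi i k * chi j l) *: klein_fourier v i j.
Proof.
transitivity (4^-1 *: (4^-1 *: \sum_j chi j l *: \sum_i chi i k *:
    (\sum_p chi i p *: \sum_q chi j q *: v p q))).
  under eq_bigr => j _ do rewrite klein_char_inversion.
  under eq_bigr => j _ do rewrite scalerA mulrC -scalerA.
  rewrite -scaler_sumr klein_char_inversion -[LHS]scale1r !scalerA.
  by congr (_ *: _); field.
congr (_ *: _); rewrite exchange_big scaler_sumr; apply: eq_bigr => j _ /=.
rewrite !scaler_sumr; apply: eq_bigr => i _.
by rewrite klein_fourierE !scalerA; congr (_ *: _); ring.
Qed.

(** Row orthogonality makes the transform of each row multiplicative in the character, which is
    [fM]. The sum over [p] then keeps only the diagonal [k = k'] by orthogonality of characters. *)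
Lemma klein_fourier_mul v m j j' :
  (forall k l l', v k l * v k l' = if l == l' then v k l else 0) ->
  \sum_p klein_fourier v p j * klein_fourier v (p + m) j' =
    klein_fourier v m (j + j').
Proof.
move=> vM.
pose f k j := \sum_l chi j l *: v k l.
have fE i j1 : klein_fourier v i j1 = 4^-1 *: \sum_k chi i k *: f k j1.
  exact: klein_fourierE.
have fM k : f k j * f k j' = f k (j + j').
  rewrite /f mulr_suml; apply: eq_bigr => l _; rewrite mulr_sumr (bigD1 l) //=.
  rewrite big1 => [|l' ll]; rewrite -scalerAl -scalerAr vM.
    by rewrite eqxx scalerA -klein_charDl addr0.
  by rewrite eq_sym (negPf ll) !scaler0.
transitivity (\sum_p \sum_k \sum_k'
    (4^-1 * 4^-1 * (chi p k * chi p k') * chi m k')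
    *: (f k j * f k' j')).
  apply: eq_bigr => p _; rewrite !fE -scalerAl -scalerAr scalerA mulr_suml.
  rewrite scaler_sumr; apply: eq_bigr => k _; rewrite mulr_sumr scaler_sumr.
  apply: eq_bigr => k' _; rewrite -scalerAl -scalerAr !scalerA; congr (_ *: _).
  by rewrite klein_charDl; ring.
rewrite exchange_big fE scaler_sumr; apply: eq_bigr => k _ /=.
rewrite exchange_big (bigD1 k) //= [X in _ + X]big1 ?addr0 => [|k' kk].
  rewrite -scaler_suml -mulr_suml -mulr_sumr klein_char_ortho eqxx mul1r fM.
  by rewrite scalerA -(mulrA 4^-1) mulVf ?mulr1 // pnatr_eq0.
rewrite -scaler_suml -mulr_suml -mulr_sumr klein_char_ortho eq_sym (negPf kk).
by rewrite mul0r mulr0 mul0r scale0r.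
Qed.
End Fourier.

(** * Commutation relations of the Fourier coefficients *)

Section MagicRelations.
Variables (R : realType) (B : algType R[i]).
Local Notation T := (bool * bool)%type.
Implicit Types (i j k l m p q : T) (v : T -> T -> B).
Local Notation fourier := (@klein_fourier R B).

Lemma kleinDD p : p + p = 0.
Proof. by case: p => [[] []]. Qed.

Lemma klein_addr_eq0 p q : (p + q == 0) = (p == q).
Proof. by case: p q => [[] []] [[] []]. Qed.

Lemma big_klein_pair (V : nmodType) (F : T -> V) i k :
  i != 0 -> k != 0 -> i != k ->
  \sum_p F p = F 0 + (F (i + k) + (F i + F k)).
Proof.
move=> i0 k0 ik; rewrite (bigD1 (0 : T)) //= (bigD1 (i + k : T)) /=.
  rewrite (bigD1 i) /=.
    rewrite (bigD1 k) /= ?big_pred0 ?addr0 //.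
      by case: i k i0 k0 ik => [[] []] [[] []] //= _ _ _ [[] []].
    by case: i k i0 k0 ik => [[] []] [[] []].
  by case: i k i0 k0 ik => [[] []] [[] []].
by case: i k i0 k0 ik => [[] []] [[] []].
Qed.

Lemma klein_fourier0 v j :
  (forall l, \sum_k v k l = 1) -> fourier v 0 j = (j == 0)%:R.
Proof.
move=> v1; rewrite /klein_fourier exchange_big /=.
under eq_bigr => l _.
  under eq_bigr => k _ do rewrite klein_charC [klein_char _ k 0]/klein_char
    !andbF expr0 mul1r.
  rewrite -scaler_sumr v1; over.
rewrite -scaler_suml sum_klein_char scalerA mulrCA mulVf ?pnatr_eq0 // mulr1.
by rewrite scaler_nat.
Qed.

Variable v : T -> T -> B.
Hypothesis v_row : forall k l l', v k l * v k l' = if l == l' then v k l else 0.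
Hypothesis v_col1 : forall l, \sum_k v k l = 1.

(** In the convolution formula for [m = i + k], the terms [p = 0] and [p = i + k] contain an entry
    of row 0 at a nonzero column, which vanishes. *)
Lemma klein_fourier_pair i k j j' : i != 0 -> k != 0 -> i != k ->
  j != 0 -> j' != 0 ->
  fourier v i j * fourier v k j' + fourier v k j * fourier v i j' =
    fourier v (i + k) (j + j').
Proof.
move=> i0 k0 ik j0 j'0; rewrite -(klein_fourier_mul (i + k) j j' v_row).
rewrite (big_klein_pair _ i0 k0 ik) klein_fourier0 // (negPf j0) mul0r add0r.
rewrite kleinDD [fourier v 0 j']klein_fourier0 // (negPf j'0) mulr0 add0r.
by rewrite addrA kleinDD add0r addrCA kleinDD addr0.
Qed.
End MagicRelations.

Section MagicCommutation.
Variables (R : realType) (B : algType R[i]).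
Local Notation T := (bool * bool)%type.
Variable v : T -> T -> B.
Hypothesis v_row : forall k l l', v k l * v k l' = if l == l' then v k l else 0.
Hypothesis v_col : forall k k' l, v k l * v k' l = if k == k' then v k l else 0.
Hypothesis v_row1 : forall k, \sum_l v k l = 1.
Hypothesis v_col1 : forall l, \sum_k v k l = 1.
Local Notation a := (klein_fourier v).

Let pairT i k j j' : i != 0 -> k != 0 -> j != j' -> j != 0 -> j' != 0 ->
  a i j * a k j' + a i j' * a k j = a (i + k) (j + j').
Proof.
move=> i0 k0 jj j0 j'0; rewrite -!(klein_fourierT v).
exact: klein_fourier_pair.
Qed.

(** Entries with a zero index are 0 or 1, hence central. For nonzero indices, sharing exactly one
    gives anticommutation, because the pair relation has right side 0. *)
Lemma klein_fourier_comm i j k l :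
  a i j * a k l = (-1) ^+ Omega (i, j) (k, l) *: (a k l * a i j).
Proof.
have aj0 i' : a i' 0 = (i' == 0)%:R by rewrite -klein_fourierT klein_fourier0.
have a0 j' : a 0 j' = (j' == 0)%:R by rewrite klein_fourier0.
have comm1 (b : bool) (x : B) : b%:R * x = x * b%:R.
  by rewrite mulr_natl mulr_natr.
have omega0 p : omega p 0 = false by case: p => [[] []].
have omega0l p : omega 0 p = false by case: p => [[] []].
have omega_ne p q : p != 0 -> q != 0 -> omega p q = (p != q).
  by case: p q => [[] []] [[] []].
rewrite /Omega /=.
have [->|i0] := eqVneq i 0.
  rewrite a0 omega0l comm1; have [->|j0] := eqVneq j 0.
    by rewrite omega0l scale1r.
  by rewrite mulr0 scaler0.
have [->|j0] := eqVneq j 0.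
  by rewrite aj0 (negPf i0) mul0r mulr0 scaler0.
have [->|k0] := eqVneq k 0.
  rewrite a0 omega0 comm1; have [->|l0] := eqVneq l 0.
    by rewrite omega0 scale1r.
  by rewrite mulr0 scaler0.
have [->|l0] := eqVneq l 0.
  by rewrite aj0 (negPf k0) mul0r mulr0 scaler0.
rewrite !omega_ne //.
have [->|ik] := eqVneq i k; have [->|jl] := eqVneq j l => /=.
- by rewrite scale1r.
- rewrite expr1 scaleN1r; apply/eqP; rewrite -addr_eq0 pairT // kleinDD a0.
  by rewrite klein_addr_eq0 (negPf jl).
- rewrite expr1 scaleN1r; apply/eqP; rewrite -addr_eq0 klein_fourier_pair //.
  by rewrite kleinDD aj0 klein_addr_eq0 (negPf ik).
(* The row and column pair relations expand the same coefficient at [(k + i, j + l)]; cancelling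
   their common product [a k j * a i l] leaves commutation. *)
- have ki : k != i by rewrite eq_sym.
  rewrite scale1r; have := klein_fourier_pair v_row v_col1 k0 i0 ki j0 l0.
  by rewrite -pairT // => /addrI.
Qed.
End MagicCommutation.

(** * Klein indexing of a magic unitary of order four *)

Section MagicUnitaryOrderFour.
Variables (R : realType) (A : cstarAlgType R) (u : 'M[A]_4).
Hypothesis hu : magic_unitary u.
Local Notation T := (bool * bool)%type.

Definition ord4_of_klein (p : T) : 'I_4 := inord (p.1 + p.2.*2).
Definition klein_of_ord4 (i : 'I_4) : T := (odd i, 1 < i)%N.

Lemma ord4_of_kleinK : cancel ord4_of_klein klein_of_ord4.
Proof. by case=> [[] []]; rewrite /klein_of_ord4 inordK. Qed.

Lemma klein_of_ord4K : cancel klein_of_ord4 ord4_of_klein.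
Proof.
by move=> i; apply: val_inj; rewrite /= inordK //; case: i => [[|[|[|[|]]]]].
Qed.

Let v (k l : T) := u (ord4_of_klein k) (ord4_of_klein l).

Let ord4_inj k l : (ord4_of_klein k == ord4_of_klein l) = (k == l).
Proof. exact/inj_eq/(can_inj ord4_of_kleinK). Qed.

Let ord4_bij : bijective ord4_of_klein.
Proof.
by exists klein_of_ord4; [exact: ord4_of_kleinK | exact: klein_of_ord4K].
Qed.

Lemma magic_klein_comm i j k l :
  klein_fourier v i j * klein_fourier v k l = (-1) ^+ Omega (i, j) (k, l) *:
    (klein_fourier v k l * klein_fourier v i j).
Proof.
apply: klein_fourier_comm => [{}k {}l l'|{}k k' {}l|{}k|{}l]; rewrite /v.
- have [->|ll] := eqVneq l l'.
    by have [] := magic_projection hu (ord4_of_klein k) (ord4_of_klein l').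
  by apply: (magic_row_ortho hu); rewrite ord4_inj.
- have [->|kk] := eqVneq k k'.
    by have [] := magic_projection hu (ord4_of_klein k') (ord4_of_klein l).
  by apply: (magic_col_ortho hu); rewrite ord4_inj.
- rewrite -(magic_row_sum hu (ord4_of_klein k)).
  by rewrite [RHS](reindex _ (onW_bij _ ord4_bij)).
- rewrite -(magic_col_sum hu (ord4_of_klein l)).
  by rewrite [RHS](reindex _ (onW_bij _ ord4_bij)).
Qed.

Lemma star_sum (I : Type) (r : seq I) (F : I -> A) :
  star (\sum_(i <- r) F i) = \sum_(i <- r) star (F i).
Proof.
elim/big_rec2: _ => [|i x y _ <-]; last by rewrite starD.
by rewrite -(subrr 1) starB star1 subrr.
Qed.

Lemma star_klein_fourier i j : star (klein_fourier v i j) = klein_fourier v i j.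
Proof.
have chiR p q : Num.conj (@klein_char R p q) = klein_char R p q.
  by rewrite rmorph_sign.
rewrite /klein_fourier starZ star_sum fmorphV rmorph_nat; congr (_ *: _).
apply: eq_bigr => k _; rewrite star_sum; apply: eq_bigr => l _.
have [st _] := magic_projection hu (ord4_of_klein k) (ord4_of_klein l).
rewrite starZ st.
by congr (_ *: _); rewrite rmorphM /=; congr (_ * _); exact: chiR.
Qed.

Lemma magic_entryE (i j : 'I_4) : u i j = 4^-1 *: \sum_k \sum_l
  (klein_char R k (klein_of_ord4 i) * klein_char R l (klein_of_ord4 j))
    *: klein_fourier v k l.
Proof. by rewrite -klein_fourierK /v !klein_of_ord4K. Qed.
End MagicUnitaryOrderFour.

(** * Irreducible representations of A_s(4) *)

Section GeneratedInvariance.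
Variables (R : realType) (A : cstarAlgType R) (H : hilbertType R).
Variables (rho : A -> {linear H -> H}) (hrho : star_representation rho).
Variables (n : nat) (u : 'M[A]_n).

(** The elements that preserve [K] together with their adjoints form a star-subalgebra containing
    the generators, so they are dense; contractivity of [rho] and closedness of [K] do the rest. *)
Lemma generated_invariant (K : set H) : magic_unitary u -> generates u ->
  closed_subspace K -> (forall x, K x -> K (rho 1 x)) ->
  (forall i j x, K x -> K (rho (u i j) x)) -> forall a x, K x -> K (rho a x).
Proof.
move=> hu gu Kc K1 Ku a x Kx.
pose S : set A :=
  [set b | forall y, K y -> K (rho b y) /\ K (rho (star b) y)]%classic.
have KD c y z : K y -> K z -> K (c *: y + z) by exact: csub_lin.
have SS : star_subalgebra S.
  split.
  - by move=> y Ky; rewrite star1; split; exact: K1.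
  - move=> c b d Sb Sd y Ky; have [? ?] := Sb y Ky; have [? ?] := Sd y Ky.
    by rewrite starD starZ !(rep_lin hrho); split; exact: KD.
  - move=> b d Sb Sd y Ky; have [by1 by2] := Sb y Ky; have [dy1 dy2] := Sd y Ky.
    rewrite starM !(repM hrho); split; first by have [] := Sb _ dy1.
    by have [] := Sd _ by2.
  - by move=> b Sb y Ky; rewrite starK; have [] := Sb y Ky.
have Su i j : S (u i j).
  by move=> y Ky; have [-> _] := magic_projection hu i j; split; exact: Ku.
apply: ((closed_rnormP K).1 (csub_closed Kc)) => e e0.
have x1 : 0 < rnorm x + 1 by rewrite ltr_wpDl // rnorm_ge0.
have [b Sb ab] := gu S SS Su a _ (divr_gt0 e0 x1).
exists (rho b x); first by have [] := Sb x Kx.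
rewrite -(repB hrho) (le_lt_trans (rep_contractive hrho _ _)) //.
move: ab; rewrite ltr_pdivlMr //; have := cstar_norm_ge0 (a - b).
by have := rnorm_ge0 x; nra.
Qed.
End GeneratedInvariance.

Theorem proposition3p1 (R : realType) (A : cstarAlgType R) (u : 'M[A]_4)
    (hA : is_As u) (H : hilbertType R) (rho : A -> {linear H -> H})
    (hrho : star_representation rho) (hirr : irreducible_rep rho) :
  has_dim H 1 \/ has_dim H 2 \/ has_dim H 4.
Proof.
have hu := As_magic hA.
pose a i j := klein_fourier
  (fun k l => u (ord4_of_klein k) (ord4_of_klein l)) i j.
apply: (@pauli_dim R H (fun v => rho (a v.1 v.2))).
- move=> v.
  have [C rC] := continuous_rnorm_bounded (rep_bounded hrho (a := a v.1 v.2)).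
  by exists C.
- by move=> v x y; rewrite (rep_star hrho) star_klein_fourier.
- move=> [i j] [k l] x; rewrite -!(repM hrho) -repZ //.
  by rewrite /a /= magic_klein_comm.
(* Fourier inversion turns invariance under the coefficients into invariance under the generators,
   and density extends it to [A]. *)
- move=> K Kc Ka; apply: (hirr.2 K Kc).
  have KZ c b x : K (rho b x) -> K (rho (c *: b) x).
    move=> Kb; rewrite repZ // -[_ *: _]addr0; apply: csub_lin => //.
    exact: csub0.
  have Ksum (I : Type) (r : seq I) (F : I -> A) x :
      (forall i, K (rho (F i) x)) -> K (rho (\sum_(i <- r) F i) x).
    move=> KF; elim/big_rec: _ => [|i b _ Kb].
      by rewrite rep0 //; exact: csub0.
    by rewrite repD // -[rho (F i) x]scale1r; apply: csub_lin.
  have Ku i j x : K x -> K (rho (u i j) x).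
    move=> Kx; rewrite magic_entryE; apply: (KZ); apply: (Ksum) => k.
    by apply: (Ksum) => l; apply: (KZ); exact: (Ka (k, l)).
  apply: (generated_invariant hrho hu (As_generated hA) Kc) => // x Kx.
  (* [rho 1] may differ from the identity, so 1 is written as a row sum of generators. *)
  by rewrite -(magic_row_sum hu ord0); apply: Ksum => j; exact: Ku.
- exact: hirr.1.
Qed.
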